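(* Let $[a,b]$ be a finite interval, let $p,q,r$ be complex-valued functions of the real variable $x\in[a,b]$, and let $\lambda\in\mathbb{C}$ be an arbitrary constant. Assume that on $[a,b]$ the equation $$(pu_0')'+qu_0=0$$ possesses a particular (complex-valued) solution $u_0$ such that the functions $u_0^2 r$ and $\dfrac{1}{u_0^2 p}$ are continuous on $[a,b]$. Let $x_0$ be an arbitrary point of $[a,b]$ such that $p$ is continuous at $x_0$ and $p(x_0)\neq 0$. Define functions $\widetilde X^{(n)}$ and $X^{(n)}$ on $[a,b]$, $n=0,1,2,\ldots$, recursively by $\widetilde X^{(0)}\equiv 1$, $X^{(0)}\equiv 1$, and for $n\ge 1$ $$\widetilde X^{(n)}(x)=\begin{cases}\displaystyle\int_{x_0}^{x}\widetilde X^{(n-1)}(s)\,u_0^2(s)\,r(s)\,ds, & n \text{ odd},\\[2mm] \displaystyle\int_{x_0}^{x}\widetilde X^{(n-1)}(s)\,\frac{1}{u_0^2(s)p(s)}\,ds, & n\text{ even},\end{cases}$$ $$X^{(n)}(x)=\begin{cases}\displaystyle\int_{x_0}^{x}X^{(n-1)}(s)\,\frac{1}{u_0^2(s)p(s)}\,ds, & n \text{ odd},\\[2mm] \displaystyle\int_{x_0}^{x}X^{(n-1)}(s)\,u_0^2(s)\,r(s)\,ds, & n\text{ even}.\end{cases}$$ Then the general solution of the equation $$(pu')'+qu=\lambda r u$$ on $(a,b)$ has the form $$u=c_1u_1+c_2u_2,$$ where $c_1,c_2$ are arbitrary complex constants and $$u_1=u_0\sum_{k=0}^{\infty}\lambda^k\widetilde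 X^{(2k)},\qquad u_2=u_0\sum_{k=0}^{\infty}\lambda^k X^{(2k+1)}.$$ Moreover, both of these series converge uniformly on $[a,b]$.
   Context: All functions are complex-valued functions of a real variable; primes denote derivatives with respect to $x$ (one-sided at the endpoints of a closed interval). A solution of $(pu')'+qu=\lambda ru$ on an interval is a function $u$ such that $u$ and $pu'$ are differentiable on that interval and the equation holds at every point of it; the equation for $u_0$ is the case $\lambda=0$. The phrase ''the general solution on $(a,b)$ has the form $u=c_1u_1+c_2u_2$'' means that $u_1$ and $u_2$ are linearly independent solutions on $(a,b)$ and that every solution on $(a,b)$ equals $c_1u_1+c_2u_2$ for some constants $c_1,c_2\in\mathbb{C}$. The integrals $\int_{x_0}^x$ are oriented (for $x<x_0$, $\int_{x_0}^x=-\int_x^{x_0}$). *)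

(* Defs.v *)
(* Stdlib reals with Coquelicot; complex numbers are Coquelicot's C, and
   complex-valued functions of a real variable have type R -> C. *)
From Stdlib Require Import Reals Arith.
From Coquelicot Require Import Coquelicot.

Open Scope C_scope.

Definition cintv (a b : R) : R -> Prop := fun x => (a <= x <= b)%R.
Definition ointv (a b : R) : R -> Prop := fun x => (a < x < b)%R.

(* C is taken as a normed module over the reals.  With [D] in place of the
   whole line this is the definition of [is_derive]; at an endpoint of an
   interval belonging to [D] it is the one-sided derivative.  Values of [f]
   outside [D] are irrelevant when [D x] holds. *)
Definition is_derive_within (D : R -> Prop) (f : R -> C) (x : R) (l : C) : Prop :=
  filterdiff (V := C_R_NormedModule) f (within D (locally x))
    (fun h : R => scal (V := C_R_NormedModule) h l).

(* [u] solves (p u')' + q u = lam r u on [D]; [du] is u' and [dv] is (p u')'. *)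
Definition SL_solution (D : R -> Prop) (p q r : R -> C) (lam : C) (u : R -> C)
    : Prop :=
  exists du dv : R -> C, forall x : R, D x ->
    is_derive_within D u x (du x) /\
    is_derive_within D (fun y => p y * du y) x (dv x) /\
    dv x + q x * u x = lam * r x * u x.

Definition lin_indep_on (D : R -> Prop) (u1 u2 : R -> C) : Prop :=
  forall c1 c2 : C,
    (forall x : R, D x -> c1 * u1 x + c2 * u2 x = 0) -> c1 = 0 /\ c2 = 0.

Definition SL_general_solution (D : R -> Prop) (p q r : R -> C) (lam : C)
    (u1 u2 : R -> C) : Prop :=
  SL_solution D p q r lam u1 /\
  SL_solution D p q r lam u2 /\
  lin_indep_on D u1 u2 /\
  (forall u : R -> C, SL_solution D p q r lam u ->
     exists c1 c2 : C, forall x : R, D x -> u x = c1 * u1 x + c2 * u2 x).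

Definition u0sq_r (r u0 : R -> C) (s : R) : C := u0 s ^ 2 * r s.

(* Division in C is total, so that this is meaningful only where
   u0 s ^ 2 * p s is nonzero. *)
Definition inv_u0sq_p (p u0 : R -> C) (s : R) : C := 1 / (u0 s ^ 2 * p s).

(* [RInt] is oriented: RInt f x0 x = - RInt f x x0. *)
Fixpoint Xtilde (p r u0 : R -> C) (x0 : R) (n : nat) (x : R) : C :=
  match n with
  | O => 1
  | S m =>
      if Nat.odd n
      then RInt (V := C_R_CompleteNormedModule)
             (fun s => Xtilde p r u0 x0 m s * u0sq_r r u0 s) x0 x
      else RInt (V := C_R_CompleteNormedModule)
             (fun s => Xtilde p r u0 x0 m s * inv_u0sq_p p u0 s) x0 x
  end.

Fixpoint X (p r u0 : R -> C) (x0 : R) (n : nat) (x : R) : C :=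
  match n with
  | O => 1
  | S m =>
      if Nat.odd n
      then RInt (V := C_R_CompleteNormedModule)
             (fun s => X p r u0 x0 m s * inv_u0sq_p p u0 s) x0 x
      else RInt (V := C_R_CompleteNormedModule)
             (fun s => X p r u0 x0 m s * u0sq_r r u0 s) x0 x
  end.

(* Sum of a complex series: the library's [Series] is real-valued only, so the
   limit is selected by [iota], as in the definition of [RInt].  The value is
   meaningful when the series converges. *)
Definition CSeries (c : nat -> C) : C :=
  iota (T := C_CompleteNormedModule) (is_series (V := C_NormedModule) c).

Definition CSeries_unif_cvg (D : R -> Prop) (f : nat -> R -> C) : Prop :=
  forall eps : R, (0 < eps)%R ->
    exists N : nat, forall n : nat, (N <= n)%nat -> forall x : R, D x ->
      (Cmod (sum_n (fun k => f k x) n - CSeries (fun k => f k x)) < eps)%R.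

Definition term1 (p r u0 : R -> C) (x0 : R) (lam : C) (k : nat) (x : R) : C :=
  lam ^ k * Xtilde p r u0 x0 (2 * k) x.

Definition term2 (p r u0 : R -> C) (x0 : R) (lam : C) (k : nat) (x : R) : C :=
  lam ^ k * X p r u0 x0 (2 * k + 1) x.

(* Main.v *)
(* Put A = lam u0^2 r and B = 1 / (u0^2 p), both extended continuously to the whole
   line by their end values.  Iterated integrals with the alternating weights A, B
   are bounded by (M |x - x0|)^n / n!, so their sums over even and over odd n
   converge locally uniformly and may be differentiated term by term; starting
   with either weight they yield two solutions (S1, T1), (S2, T2) of the system
   S' = B T, T' = A S.  Then u = u0 S satisfies p u' = (p u0') S + T / u0 and solves
   (p u')' + q u = lam r u.  The Wronskian of the two solutions so obtained is
   S1 T2 - T1 S2, which is constant and equals 1 at x0.  Any solution u is then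
   W(u, u2) u1 - W(u, u1) u2, where both Wronskians are constant on (a, b). *)
Require Import Defs.
From Stdlib Require Import Reals Arith Lra Lia FunctionalExtensionality.
From Coquelicot Require Import Coquelicot.

Open Scope C_scope.

(** * Limits, sums, products and inverses in the complex numbers *)

Notation is_derive_C := (is_derive (K := R_AbsRing) (V := C_R_NormedModule)).

(** The neighbourhoods used by [continuous] and [RInt] on C are those of pairs of reals, with
    squares as balls; [locally_C] identifies them with those given by the modulus, in which the
    estimates below are made. *)
Lemma filterlim_C {T : Type} {F : (T -> Prop) -> Prop} {FF : Filter F} (f : T -> C) (l : C) :
  filterlim f F (locally l) <->
  (forall eps : R, (0 < eps)%R -> F (fun t => (Cmod (f t - l) < eps)%R)).
Proof.
  split.
  - intros H eps He.
    apply (H (fun z => (Cmod (z - l) < eps)%R)), locally_C. exists (mkposreal _ He). intros y Hy. exact Hy.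
  - intros H P HP. apply locally_C in HP. destruct HP as [eps He].
    unfold filtermap. generalize (H eps (cond_pos eps)). apply filter_imp. intros t Ht. apply He, Ht.
Qed.

Lemma filterlim_Cplus {T : Type} {F : (T -> Prop) -> Prop} {FF : Filter F} (f g : T -> C) (l m : C) :
  filterlim f F (locally l) -> filterlim g F (locally m) ->
  filterlim (fun t => f t + g t) F (locally (l + m)).
Proof.
  intros Hf Hg. apply (filterlim_comp_2 f g _ Hf Hg).
  apply (filterlim_plus (V := C_R_NormedModule)).
Qed.

Lemma filterlim_Cmult {T : Type} {F : (T -> Prop) -> Prop} {FF : Filter F} (f g : T -> C) (l m : C) :
  filterlim f F (locally l) -> filterlim g F (locally m) ->
  filterlim (fun t => f t * g t) F (locally (l * m)).
Proof.
  intros Hf Hg.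
  (* The product is read as scalar multiplication of C over itself; the scalar then carries the
     topology of the absolute ring, to which the limit of [f] is transferred. *)
  assert (Hf' : filterlim f F (locally (T := AbsRing_UniformSpace C_AbsRing) l)).
  { intros P HP. apply Hf, locally_C, HP. }
  apply (filterlim_comp_2 f g _ Hf' Hg).
  apply (filterlim_scal (V := C_NormedModule)).
Qed.

Lemma continuous_Cmult (f g : R -> C) (x : R) :
  continuous f x -> continuous g x -> continuous (fun s => f s * g s) x.
Proof. apply filterlim_Cmult. Qed.

Lemma filterlim_Cinv {T : Type} {F : (T -> Prop) -> Prop} {FF : Filter F} (f : T -> C) (l : C) :
  l <> 0 -> filterlim f F (locally l) ->
  filterlim (fun t => / f t) F (locally (/ l)).
Proof.
  intros Hl Hf. rewrite filterlim_C in Hf. apply filterlim_C. intros eps He.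
  pose proof (proj1 (Cmod_gt_0 l) Hl) as Hm.
  set (m := Cmod l) in *.
  (* The first bound keeps [Cmod (f t)] above [m / 2]; the second then makes
     [Cmod (f t - l) / (Cmod (f t) * m)] smaller than [eps]. *)
  assert (Hd : (0 < Rmin (m / 2) (eps * (m * m) / 2))%R).
  { apply Rmin_pos; [lra|]. apply Rdiv_lt_0_compat; [|lra].
    apply Rmult_lt_0_compat; [exact He|]. now apply Rmult_lt_0_compat. }
  generalize (Hf _ Hd). apply filter_imp. intros t Ht.
  pose proof (Rmin_l (m / 2) (eps * (m * m) / 2)).
  pose proof (Rmin_r (m / 2) (eps * (m * m) / 2)).
  assert (Hft : (m / 2 < Cmod (f t))%R).
  { assert (E : l = f t + - (f t - l)) by ring.
    pose proof (Cmod_triangle (f t) (- (f t - l))) as Htr.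
    rewrite <- E, Cmod_opp in Htr. fold m in Htr. lra. }
  assert (Hnz : f t <> 0) by (apply Cmod_gt_0; lra).
  replace (/ f t - / l) with (- (f t - l) / (f t * l)) by (now field).
  rewrite Cmod_div, Cmod_opp, Cmod_mult by (now apply Cmult_neq_0).
  fold m.
  assert (0 < Cmod (f t) * m)%R by (apply Rmult_lt_0_compat; lra).
  apply (Rmult_lt_reg_r (Cmod (f t) * m)); [assumption|].
  unfold Rdiv. rewrite Rmult_assoc, Rinv_l, Rmult_1_r by lra.
  assert (eps * m * (m / 2) <= eps * m * Cmod (f t))%R.
  { apply Rmult_le_compat_l; [|lra]. apply Rmult_le_pos; lra. }
  lra.
Qed.

(** * Derivatives relative to a set *)

Section Derivative_within.

Variable D : R -> Prop.
Variable x : R.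
Hypothesis Dx : D x.

(* Caratheodory's form of the derivative, from which the product and quotient
   rules within [D] follow by continuity alone. *)
Lemma is_derive_within_slope (f : R -> C) (l : C) :
  is_derive_within D f x l <->
  exists phi : R -> C, filterlim phi (within D (locally x)) (locally l) /\
    forall y, D y -> f y - f x = (y - x)%R * phi y.
Proof.
  split.
  - intros [_ H].
    (* The filter [within D (locally x)] does not exclude the point [x], so the slope is completed
       there by its limit [l]. *)
    exists (fun y => match Req_EM_T y x with
              | left _ => l | right _ => (f y - f x) / (y - x)%R end).
    split.
    + apply filterlim_C. intros eps He.
      assert (He2 : (0 < eps / 2)%R) by lra.
      (* [filterdiff] states its estimate at every limit point of the filter; [x] is one of them. *)
      assert (Hlim : is_filter_lim (within D (locally x)) x).
      { intros P HP. unfold within. revert HP. apply filter_imp. auto. }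
      generalize (H x Hlim (mkposreal _ He2)). apply filter_imp.
      intros y Hy. destruct (Req_EM_T y x) as [E|E].
      * replace (l - l) with (RtoC 0) by ring. rewrite Cmod_0. exact He.
      * assert (Hyx : (y - x)%R <> 0%R) by lra.
        assert (HyxC : RtoC (y - x) <> 0) by (intros HH; apply Hyx; now injection HH).
        replace ((f y - f x) / (y - x)%R - l) with
          ((f y - f x - (y - x)%R * l) / (y - x)%R) by (now field).
        rewrite Cmod_div by exact HyxC.
        rewrite Cmod_R.
        assert (0 < Rabs (y - x))%R by (now apply Rabs_pos_lt).
        apply (Rmult_lt_reg_r (Rabs (y - x))); [assumption|].
        unfold Rdiv. rewrite Rmult_assoc, Rinv_l, Rmult_1_r by lra.
        rewrite <- Cmod_norm in Hy.
        change (Cmod (f y - f x - scal (V := C_R_NormedModule) (y - x)%R l) <= eps / 2 * Rabs (y - x))%R in Hy.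
        rewrite scal_R_Cmult in Hy.
        eapply Rle_lt_trans; [exact Hy|].
        apply Rmult_lt_compat_r; lra.
    + intros y _. destruct (Req_EM_T y x) as [E|E].
      * subst y. replace (x - x)%R with 0%R by ring. ring.
      * assert (HyxC : RtoC (y - x) <> 0).
        { intros HH; apply E. apply (f_equal fst) in HH. simpl in HH. lra. }
        now field.
  - intros [phi [Hphi Hf]]. split.
    + apply (is_linear_scal_l (K := R_AbsRing) (V := C_R_NormedModule)).
    + intros x' Hx'.
      (* Conversely [x] is the only limit point: as [D x] holds, every set of the filter contains
         [x], and a ball around a different point would miss it. *)
      assert (E : x = x').
      { destruct (Req_EM_T x x') as [E|E]; [exact E|exfalso].
        assert (Hp : (0 < Rabs (x - x'))%R) by (apply Rabs_pos_lt; lra).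
        assert (H : within D (locally x) (fun y => (Rabs (y - x') < Rabs (x - x'))%R)).
        { apply Hx'. exists (mkposreal _ Hp). intros y Hy. exact Hy. }
        apply locally_singleton in H. specialize (H Dx). lra. }
      subst x'. intros eps. rewrite filterlim_C in Hphi.
      generalize (Hphi eps (cond_pos eps)). unfold within. apply filter_imp. intros y Hy Dy. specialize (Hy Dy).
      rewrite <- Cmod_norm.
      change (Cmod (f y - f x - scal (V := C_R_NormedModule) (y - x)%R l) <= eps * Rabs (y - x))%R.
      rewrite scal_R_Cmult, Hf by exact Dy.
      replace ((y - x)%R * phi y - (y - x)%R * l) with ((y - x)%R * (phi y - l)) by ring.
      rewrite Cmod_mult, Cmod_R, Rmult_comm.
      apply Rmult_le_compat_r; [apply Rabs_pos|]. now left.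
Qed.

Lemma is_derive_within_continuous (f : R -> C) (l : C) :
  is_derive_within D f x l -> filterlim f (within D (locally x)) (locally (f x)).
Proof.
  intros H. apply is_derive_within_slope in H as [phi [Hphi Hf]].
  assert (Hid : filterlim (fun y => RtoC (y - x)) (within D (locally x)) (locally (RtoC 0))).
  { apply filterlim_C. intros eps He. exists (mkposreal _ He). intros y Hy _.
    replace (RtoC (y - x) - 0) with (RtoC (y - x)) by ring.
    rewrite Cmod_R. exact Hy. }
  assert (Hl := filterlim_Cplus _ _ _ _ (filterlim_const (f x)) (filterlim_Cmult _ _ _ _ Hid Hphi)).
  replace (f x + 0 * l) with (f x) in Hl by ring.
  revert Hl. apply filterlim_ext_loc.
  apply (filter_forall (F := locally x)). intros y Dy. rewrite <- Hf by exact Dy. ring.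
Qed.

Lemma is_derive_within_ext (f g : R -> C) (l : C) :
  (forall y, D y -> f y = g y) -> is_derive_within D f x l -> is_derive_within D g x l.
Proof.
  intros E H. apply is_derive_within_slope in H as [phi [Hphi Hf]].
  apply is_derive_within_slope. exists phi. split; [exact Hphi|].
  intros y Dy. rewrite <- !E by assumption. now apply Hf.
Qed.

Lemma is_derive_within_plus (f g : R -> C) (l m : C) :
  is_derive_within D f x l -> is_derive_within D g x m ->
  is_derive_within D (fun y => f y + g y) x (l + m).
Proof.
  rewrite !is_derive_within_slope. intros [phi [Hphi Hf]] [psi [Hpsi Hg]].
  exists (fun y => phi y + psi y). split; [now apply filterlim_Cplus|].
  intros y Dy. rewrite Cmult_plus_distr_l, <- Hf, <- Hg by exact Dy. ring.
Qed.

Lemma is_derive_within_const (c : C) : is_derive_within D (fun _ => c) x 0.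
Proof.
  apply is_derive_within_slope. exists (fun _ => 0). split; [apply filterlim_const|].
  intros y _. ring.
Qed.

Lemma is_derive_within_mult (f g : R -> C) (l m : C) :
  is_derive_within D f x l -> is_derive_within D g x m ->
  is_derive_within D (fun y => f y * g y) x (l * g x + f x * m).
Proof.
  intros H1 H2. pose proof (is_derive_within_continuous _ _ H2) as Hc.
  revert H1 H2. rewrite !is_derive_within_slope.
  intros [phi [Hphi Hf]] [psi [Hpsi Hg]].
  exists (fun y => phi y * g y + f x * psi y). split.
  - apply filterlim_Cplus; apply filterlim_Cmult; try assumption. apply filterlim_const.
  - intros y Dy.
    replace ((y - x)%R * (phi y * g y + f x * psi y)) with
      (((y - x)%R * phi y) * g y + f x * ((y - x)%R * psi y)) by ring.
    rewrite <- Hf, <- Hg by exact Dy. ring.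
Qed.

Lemma is_derive_within_inv (f : R -> C) (l : C) :
  (forall y, D y -> f y <> 0) -> is_derive_within D f x l ->
  is_derive_within D (fun y => / f y) x (- l / (f x * f x)).
Proof.
  intros Hnz H. pose proof (is_derive_within_continuous _ _ H) as Hc.
  revert H. rewrite !is_derive_within_slope. intros [phi [Hphi Hf]].
  exists (fun y => - (1) * phi y * (/ f y * / f x)). split.
  - replace (- l / (f x * f x)) with (- (1) * l * (/ f x * / f x)) by (field; now apply Hnz).
    repeat apply filterlim_Cmult; try apply filterlim_const; try assumption.
    apply filterlim_Cinv; [now apply Hnz|assumption].
  - intros y Dy.
    replace ((y - x)%R * (- (1) * phi y * (/ f y * / f x))) with
      (- ((y - x)%R * phi y) * (/ f y * / f x)) by ring.
    rewrite <- Hf by exact Dy. field. split; now apply Hnz.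
Qed.

End Derivative_within.

(** A smaller set gives a finer filter, so the same slope function serves. This leads from the
    closed to the open interval, and from the whole line to [D]. *)
Lemma is_derive_within_subset (D D' : R -> Prop) (f : R -> C) (x : R) (l : C) :
  (forall y, D' y -> D y) -> D' x -> is_derive_within D f x l -> is_derive_within D' f x l.
Proof.
  intros HD Dx H. apply is_derive_within_slope in H as [phi [Hphi Hf]]; [|now apply HD].
  apply is_derive_within_slope; [exact Dx|]. exists phi. split; [|auto].
  intros P HP. generalize (Hphi P HP). unfold filtermap, within.
  apply filter_imp. auto.
Qed.

Lemma is_derive_is_derive_within (D : R -> Prop) (f : R -> C) (x : R) (l : C) :
  D x -> is_derive_C f x l -> is_derive_within D f x l.
Proof.
  intros Dx H. apply (is_derive_within_subset (fun _ => True)); auto.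
  destruct H as [Hl H]. split; [exact Hl|]. intros x' Hx' eps.
  assert (Hx'' : is_filter_lim (locally x) x').
  { intros P HP. generalize (Hx' P HP). unfold within. apply filter_imp. auto. }
  generalize (H x' Hx'' eps). unfold within. apply filter_imp. auto.
Qed.

Lemma is_derive_within_is_derive (D : R -> Prop) (f : R -> C) (x : R) (l : C) :
  locally x D -> is_derive_within D f x l -> is_derive_C f x l.
Proof.
  intros Dx [Hl H]. split; [exact Hl|]. intros x' Hx' eps.
  assert (Hx'' : is_filter_lim (within D (locally x)) x').
  { intros P HP. generalize (Hx' P HP). unfold within. apply filter_imp. auto. }
  generalize (filter_and _ _ Dx (H x' Hx'' eps)). apply filter_imp.
  intros y [Dy Hy]. exact (Hy Dy).
Qed.

Lemma locally_ointv (a b x : R) : ointv a b x -> locally x (ointv a b).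
Proof.
  intros Hx.
  apply (open_and (fun y : R => (a < y)%R) (fun y : R => (y < b)%R)).
  - apply open_gt.
  - apply open_lt.
  - exact Hx.
Qed.

Lemma is_derive_within_zero_const (a b : R) (f : R -> C) :
  (forall x, ointv a b x -> is_derive_within (ointv a b) f x 0) ->
  forall x y, ointv a b x -> ointv a b y -> f x = f y.
Proof.
  intros H.
  assert (Hlt : forall x y, ointv a b x -> ointv a b y -> (x < y)%R -> f x = f y).
  { intros x y Hx Hy Hxy. apply (eq_is_derive (V := C_R_NormedModule)); [|exact Hxy].
    intros t Ht. assert (Ht' : ointv a b t) by (unfold ointv in *; lra).
    apply is_derive_within_is_derive with (ointv a b); [now apply locally_ointv|now apply H]. }
  intros x y Hx Hy. destruct (Rtotal_order x y) as [E|[E|E]].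
  - now apply Hlt.
  - now subst.
  - symmetry. now apply Hlt.
Qed.

(** This permits a linear relation between solutions to be differentiated. If [l] were non-zero, the
    slope at the nearby point [x + d / 2] would lie within [Cmod l] of [l], yet it vanishes
    there. *)
Lemma is_derive_within_zero (a b : R) (f : R -> C) (x : R) (l : C) :
  ointv a b x -> (forall y, ointv a b y -> f y = 0) ->
  is_derive_within (ointv a b) f x l -> l = 0.
Proof.
  intros Hx Hf H. apply is_derive_within_slope in H as [phi [Hphi Hs]]; [|exact Hx].
  destruct (Ceq_dec l 0) as [E|E]; [exact E|exfalso].
  rewrite filterlim_C in Hphi.
  destruct (filter_and _ _ (locally_ointv _ _ _ Hx) (Hphi _ (proj1 (Cmod_gt_0 l) E))) as [d Hd].
  pose proof (cond_pos d) as Hd0.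
  destruct (Hd (x + d / 2)%R) as [Dy Hy].
  { change (Rabs (x + d / 2 - x) < d)%R.
    replace (x + d / 2 - x)%R with (d / 2)%R by ring. rewrite Rabs_pos_eq; lra. }
  specialize (Hy Dy). specialize (Hs _ Dy).
  rewrite !Hf in Hs by assumption.
  assert (Hphi0 : phi (x + d / 2)%R = 0).
  { replace (phi (x + d / 2)%R) with ((0 - 0) / RtoC (x + d / 2 - x)).
    - unfold Cdiv. ring.
    - rewrite Hs. field. intros H. apply (f_equal fst) in H. simpl in H. lra. }
  rewrite Hphi0 in Hy. replace (0 - l) with (- l) in Hy by ring. rewrite Cmod_opp in Hy. lra.
Qed.

(** * Iterated integrals with a sequence of weights *)

(** This is the inductive step of the factorial bound: each integration raises the power of the
    distance to [x0] by one and divides by the new exponent. *)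
Lemma Cmod_RInt_le_pow (f : R -> C) (K : R) (n : nat) (x0 x : R) (I : C) :
  (forall s, (Cmod (f s) <= K * Rabs (s - x0) ^ n)%R) ->
  is_RInt (V := C_R_NormedModule) f x0 x I ->
  (Cmod I <= K * Rabs (x - x0) ^ S n / INR (S n))%R.
Proof.
  intros Hf HI.
  assert (Hn : (0 < INR (S n))%R) by apply lt_0_INR, Nat.lt_0_succ.
  (* [e] stands for the sign of [s - x0]. On each side of [x0] it replaces the absolute value by a
     polynomial with an explicit antiderivative. *)
  assert (HG : forall e y z : R, (e * e = 1)%R ->
    is_RInt (fun s => K * (e * (s - x0)) ^ n)%R y z
      (K * e * (e * (z - x0)) ^ S n / INR (S n) - K * e * (e * (y - x0)) ^ S n / INR (S n))%R).
  { intros e y z He.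
    apply (is_RInt_derive (V := R_CompleteNormedModule)
      (fun s => K * e * (e * (s - x0)) ^ S n / INR (S n))%R).
    - intros s _. auto_derive; [exact Logic.I|].
      change (Init.Nat.pred (S n)) with n.
      transitivity ((e * e) * (K * (e * (s - x0)) ^ n))%R; [|rewrite He; ring].
      change (match n with O => 1 | S _ => INR n + 1 end)%R with (INR (S n)).
      unfold Rminus. generalize ((e * (s + - x0)) ^ n)%R. intros t. field. lra.
    - intros s _. apply (ex_derive_continuous (K := R_AbsRing) (V := R_NormedModule)). auto_derive. exact Logic.I. }
  destruct (Rle_dec x0 x) as [Hx|Hx].
  - pose proof (norm_RInt_le f (fun s => K * (1 * (s - x0)) ^ n)%R x0 x I) as H.
    rewrite Cmod_norm. eapply Rle_trans; [eapply H|].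
    + exact Hx.
    + intros s Hs. rewrite <- Cmod_norm. eapply Rle_trans; [apply Hf|].
      rewrite Rabs_pos_eq, Rmult_1_l by lra. lra.
    + exact HI.
    + apply HG. ring.
    + rewrite Rabs_pos_eq by lra.
      replace (x0 - x0)%R with 0%R by ring. rewrite Rmult_0_r, pow_i, !Rmult_1_l, !Rmult_1_r by lia.
      unfold Rdiv. rewrite Rmult_0_r, Rmult_0_l. lra.
  - apply is_RInt_swap in HI.
    pose proof (norm_RInt_le f (fun s => K * (-1 * (s - x0)) ^ n)%R x x0 (opp I)) as H.
    rewrite <- Cmod_opp, Cmod_norm. eapply Rle_trans; [eapply H|].
    + lra.
    + intros s Hs. rewrite <- Cmod_norm. eapply Rle_trans; [apply Hf|].
      rewrite Rabs_left1 by lra. replace (-1 * (s - x0))%R with (- (s - x0))%R by ring. lra.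
    + exact HI.
    + apply HG. ring.
    + rewrite Rabs_left1 by lra.
      replace (x0 - x0)%R with 0%R by ring. rewrite Rmult_0_r, pow_i by lia.
      replace (-1 * (x - x0))%R with (- (x - x0))%R by ring.
      unfold Rdiv. rewrite Rmult_0_r, Rmult_0_l. lra.
Qed.

(** A weight is indexed by the stage that uses it, as in the parity test of [Xtilde] and [X];
    alternation, rescaling and extension then become changes of [w] alone. *)
Fixpoint iter_int (w : nat -> R -> C) (x0 : R) (n : nat) (x : R) : C :=
  match n with
  | O => 1
  | S m => RInt (V := C_R_CompleteNormedModule) (fun s => iter_int w x0 m s * w (S m) s) x0 x
  end.

Section Iterated_integrals.

Variable w : nat -> R -> C.
Variable x0 : R.
Hypothesis w_cont : forall n x, continuous (w n) x.

(** Integrability, differentiability and continuity depend on each other along the recursion.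
    Continuity at stage [n] is a premise here and in the next lemma; [continuous_iter_int]
    discharges it by induction. *)
Lemma iter_int_correct_aux (n : nat) :
  (forall x, continuous (iter_int w x0 n) x) ->
  forall x, is_RInt (V := C_R_NormedModule) (fun s => iter_int w x0 n s * w (S n) s) x0 x
    (iter_int w x0 (S n) x).
Proof.
  intros H x. apply (RInt_correct (V := C_R_CompleteNormedModule)).
  apply (ex_RInt_continuous (V := C_R_CompleteNormedModule)). intros z _.
  now apply continuous_Cmult.
Qed.

Lemma is_derive_iter_int_aux (n : nat) :
  (forall x, continuous (iter_int w x0 n) x) ->
  forall x, is_derive_C (iter_int w x0 (S n)) x (iter_int w x0 n x * w (S n) x).
Proof.
  intros H x.
  apply (is_derive_RInt (V := C_R_NormedModule) (fun s => iter_int w x0 n s * w (S n) s) _ x0).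
  - apply filter_forall. now apply iter_int_correct_aux.
  - now apply continuous_Cmult.
Qed.

Lemma continuous_iter_int (n : nat) (x : R) : continuous (iter_int w x0 n) x.
Proof.
  revert x. induction n as [|n IH]; intros x.
  - apply (continuous_const (V := C_UniformSpace)).
  - apply (ex_derive_continuous (K := R_AbsRing) (V := C_R_NormedModule)).
    eexists. now apply is_derive_iter_int_aux.
Qed.

Lemma is_RInt_iter_int (n : nat) (x : R) :
  is_RInt (V := C_R_NormedModule) (fun s => iter_int w x0 n s * w (S n) s) x0 x
    (iter_int w x0 (S n) x).
Proof. apply iter_int_correct_aux, continuous_iter_int. Qed.

Lemma is_derive_iter_int (n : nat) (x : R) :
  is_derive_C (iter_int w x0 (S n)) x (iter_int w x0 n x * w (S n) x).
Proof. apply is_derive_iter_int_aux, continuous_iter_int. Qed.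

Lemma iter_int_at (n : nat) : iter_int w x0 (S n) x0 = 0.
Proof. apply (RInt_point (V := C_R_CompleteNormedModule)). Qed.

Lemma Cmod_iter_int_le (M : R) (n : nat) (x : R) :
  (forall n x, (Cmod (w n x) <= M)%R) ->
  (Cmod (iter_int w x0 n x) <= M ^ n * Rabs (x - x0) ^ n / INR (fact n))%R.
Proof.
  intros HM.
  revert x. induction n as [|n IH]; intros x.
  - simpl. rewrite Cmod_1. lra.
  - assert (Hfn : (0 < INR (fact n))%R) by apply INR_fact_lt_0.
    assert (HSn : (0 < INR (S n))%R) by apply lt_0_INR, Nat.lt_0_succ.
    replace (M ^ S n * Rabs (x - x0) ^ S n / INR (fact (S n)))%R
      with (M ^ S n / INR (fact n) * Rabs (x - x0) ^ S n / INR (S n))%R.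
    2: { rewrite fact_simpl, mult_INR. field. lra. }
    apply (Cmod_RInt_le_pow (fun s => iter_int w x0 n s * w (S n) s) _ n x0).
    2: apply is_RInt_iter_int.
    intros s. rewrite Cmod_mult.
    replace (M ^ S n / INR (fact n) * Rabs (s - x0) ^ n)%R
      with (M ^ n * Rabs (s - x0) ^ n / INR (fact n) * M)%R by (simpl; field; lra).
    apply Rmult_le_compat; auto using Cmod_ge_0.
Qed.

End Iterated_integrals.

(** * Uniform convergence of complex series *)

(** Domination provides a limit by completeness, and uniqueness of limits forces [iota] to select
    it. *)
Lemma CSeries_correct (a : nat -> C) (c : nat -> R) :
  ex_series c -> (forall k, (Cmod (a k) <= c k)%R) ->
  is_series (V := C_NormedModule) a (CSeries a).
Proof.
  intros Hc Ha.
  destruct (ex_series_le (V := C_CompleteNormedModule) a c Ha Hc) as [l Hl].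
  unfold CSeries. rewrite (iota_unique (V := C_CompleteNormedModule) _ l); [exact Hl| |exact Hl].
  intros y Hy. exact (filterlim_locally_unique (V := C_NormedModule) _ _ _ Hy Hl).
Qed.

Lemma is_series_filterlim_C (a : nat -> C) (l : C) :
  is_series (V := C_NormedModule) a l ->
  filterlim (sum_n a) eventually (locally l).
Proof. intros H P HP. apply H. exact HP. Qed.

Lemma CSeries_unif_cvg_M_test (D : R -> Prop) (f : nat -> R -> C) (c : nat -> R) :
  ex_series c -> (forall k x, D x -> (Cmod (f k x) <= c k)%R) -> CSeries_unif_cvg D f.
Proof.
  intros [l Hl] Hf eps He.
  assert (He4 : (0 < eps / 4)%R) by lra.
  destruct (proj1 (filterlim_locally (U := R_UniformSpace) (sum_n c) l) Hl (mkposreal _ He4)) as [N HN].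
  exists N. intros n Hn x Dx.
  assert (Hs := CSeries_correct (fun k => f k x) c (ex_intro _ l Hl) (fun k => Hf k x Dx)).
  apply is_series_filterlim_C in Hs. rewrite filterlim_C in Hs.
  destruct (Hs _ He4) as [N' HN'].
  (* [N'] depends on [x], but [m] is only an intermediate index: the distance between the partial
     sums at [n] and [m] is controlled by the tail of [c], with an [N] common to all [x]. *)
  set (m := (n + N')%nat).
  assert (Hdiff : forall j, (Cmod (sum_n (fun k => f k x) (n + j) - sum_n (fun k => f k x) n)
     <= sum_n c (n + j) - sum_n c n)%R).
  { induction j as [|j IH].
    - rewrite Nat.add_0_r.
      replace (sum_n (fun k => f k x) n - sum_n (fun k => f k x) n) with (RtoC 0) by ring.
      rewrite Cmod_0. lra.
    - rewrite Nat.add_succ_r, !sum_Sn.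
      change (Cmod (sum_n (fun k => f k x) (n + j) + f (S (n + j)) x - sum_n (fun k => f k x) n)
        <= sum_n c (n + j) + c (S (n + j)) - sum_n c n)%R.
      replace (sum_n (fun k => f k x) (n + j) + f (S (n + j)) x - sum_n (fun k => f k x) n)
        with ((sum_n (fun k => f k x) (n + j) - sum_n (fun k => f k x) n) + f (S (n + j)) x) by ring.
      eapply Rle_trans; [apply Cmod_triangle|]. specialize (Hf (S (n + j)) x Dx). lra. }
  assert (HB : (sum_n c m - sum_n c n < eps / 2)%R).
  { assert (H1 : (Rabs (sum_n c n - l) < eps / 4)%R) by exact (HN n Hn).
    assert (H2 : (Rabs (sum_n c m - l) < eps / 4)%R) by (apply (HN m); lia).
    apply Rabs_def2 in H1, H2. lra. }
  replace (sum_n (fun k => f k x) n - CSeries (fun k => f k x)) with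
    (- (sum_n (fun k => f k x) m - sum_n (fun k => f k x) n) +
     (sum_n (fun k => f k x) m - CSeries (fun k => f k x))) by ring.
  eapply Rle_lt_trans; [apply Cmod_triangle|]. rewrite Cmod_opp.
  specialize (HN' m ltac:(lia)). specialize (Hdiff N'). fold m in Hdiff. lra.
Qed.

(** * Termwise differentiation *)

(* The mean value inequality is applied to [s n t - t * g x], whose derivative is
   uniformly small near [x]. *)
Lemma is_derive_sequence_limit (s ds : nat -> R -> C) (f g : R -> C) (x L : R) :
  (0 < L)%R ->
  (forall n t, is_derive_C (s n) t (ds n t)) ->
  (forall n t, continuous (ds n) t) ->
  (forall t, (Rabs (t - x) < L)%R -> filterlim (fun n => s n t) eventually (locally (f t))) ->
  (forall eps : R, (0 < eps)%R -> exists N, forall n, (N <= n)%nat ->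
     forall t, (Rabs (t - x) < L)%R -> (Cmod (ds n t - g t) < eps)%R) ->
  is_derive_C f x (g x).
Proof.
  intros HL Hs Hds Hf Hg.
  (* [ds n t] is compared with [g x] through [g t], [ds N t] and [ds N x]. Continuity of the single
     function [ds N] fixes [d]; uniform convergence extends the bound to all later [n]. *)
  assert (Hunif : forall eps : R, (0 < eps)%R -> exists d : posreal, exists N,
    (d <= L)%R /\ forall n t, (N <= n)%nat -> (Rabs (t - x) < d)%R -> (Cmod (ds n t - g x) <= eps)%R).
  { intros eps He. assert (He4 : (0 < eps / 6)%R) by lra.
    destruct (Hg _ He4) as [N HN].
    pose proof (Hds N x) as Hc. unfold continuous in Hc. rewrite filterlim_C in Hc.
    destruct (Hc _ He4) as [d Hd].
    assert (Hm : (0 < Rmin d L)%R) by (apply Rmin_pos; [apply cond_pos|exact HL]).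
    exists (mkposreal _ Hm), N. split; [apply Rmin_r|].
    intros n t Hn Ht. simpl in Ht.
    assert (Ht1 : (Rabs (t - x) < d)%R) by (eapply Rlt_le_trans; [exact Ht|apply Rmin_l]).
    assert (Ht2 : (Rabs (t - x) < L)%R) by (eapply Rlt_le_trans; [exact Ht|apply Rmin_r]).
    assert (Hx : (Rabs (x - x) < L)%R) by (rewrite Rminus_diag, Rabs_R0; exact HL).
    pose proof (HN n Hn t Ht2) as H1. pose proof (HN N (Nat.le_refl N) t Ht2) as H2.
    pose proof (HN N (Nat.le_refl N) x Hx) as H3. specialize (Hd t Ht1).
    replace (ds n t - g x) with ((ds n t - g t) + (- (ds N t - g t) + ((ds N t - ds N x) + (ds N x - g x)))) by ring.
    eapply Rle_trans; [apply Cmod_triangle|].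
    assert (H4 := Cmod_triangle (- (ds N t - g t)) ((ds N t - ds N x) + (ds N x - g x))).
    assert (H5 := Cmod_triangle (ds N t - ds N x) (ds N x - g x)).
    rewrite Cmod_opp in H4. lra. }
  assert (Hmean : forall eps : R, (0 < eps)%R -> exists d : posreal, forall y, (Rabs (y - x) < d)%R ->
    (Cmod (f y - f x - (y - x)%R * g x) <= eps * Rabs (y - x))%R).
  { intros eps He. destruct (Hunif eps He) as [d [N [HdL Hd]]]. exists d. intros y Hy.
    assert (Hn : forall n, (N <= n)%nat -> (Cmod (s n y - s n x - (y - x)%R * g x) <= eps * Rabs (y - x))%R).
    { intros n Hn. rewrite Cmod_norm, Rmult_comm, <- scal_R_Cmult.
      apply (norm_RInt_le_const_abs (V := C_R_NormedModule) (fun t => ds n t - g x) x y).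
      - intros t Ht. rewrite <- Cmod_norm. apply Hd; [exact Hn|].
        revert Ht Hy. unfold Rmin, Rmax, Rabs. destruct (Rle_dec x y); repeat destruct Rcase_abs; lra.
      - apply (is_RInt_minus (V := C_R_NormedModule) (ds n) (fun _ => g x)).
        + apply (is_RInt_derive (V := C_R_CompleteNormedModule)); auto.
        + apply (is_RInt_const (V := C_R_NormedModule)). }
    (* The bound passes to the limit: an excess there would be a positive margin, and a late enough
       term of the sequence would exceed the bound too. *)
    apply Rnot_lt_le. intros Hlt.
    assert (Hx : (Rabs (x - x) < L)%R) by (rewrite Rminus_diag, Rabs_R0; exact HL).
    assert (Hlim : filterlim (fun n => s n y + (- (1) * s n x + - ((y - x)%R * g x))) eventually
      (locally (f y + (- (1) * f x + - ((y - x)%R * g x))))).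
    { repeat apply filterlim_Cplus; try apply filterlim_Cmult; try apply filterlim_const; apply Hf; lra. }
    rewrite filterlim_C in Hlim.
    assert (Hgap : (0 < Cmod (f y - f x - (y - x)%R * g x) - eps * Rabs (y - x))%R) by lra.
    destruct (Hlim _ Hgap) as [N' HN'].
    specialize (HN' (N + N')%nat ltac:(lia)). specialize (Hn (N + N')%nat ltac:(lia)).
    revert HN' Hn. generalize (s (N + N')%nat y) (s (N + N')%nat x). intros sy sx H1 H2.
    assert (H3 := Cmod_triangle (sy - sx - (y - x)%R * g x)
      (- ((sy + (- (1) * sx + - ((y - x)%R * g x))) - (f y + (- (1) * f x + - ((y - x)%R * g x)))))).
    rewrite Cmod_opp in H3.
    replace (sy - sx - (y - x)%R * g x +
      - ((sy + (- (1) * sx + - ((y - x)%R * g x))) - (f y + (- (1) * f x + - ((y - x)%R * g x)))))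
      with (f y - f x - (y - x)%R * g x) in H3 by ring.
    lra. }
  split; [apply (is_linear_scal_l (K := R_AbsRing) (V := C_R_NormedModule))|].
  intros x' Hx'. apply (is_filter_lim_locally_unique (V := R_NormedModule)) in Hx'. subst x'.
  intros eps. destruct (Hmean eps (cond_pos eps)) as [d Hd]. exists d. intros y Hy.
  rewrite <- Cmod_norm.
  change (Cmod (f y - f x - scal (V := C_R_NormedModule) (y - x)%R (g x)) <= eps * Rabs (y - x))%R.
  rewrite scal_R_Cmult. apply Hd, Hy.
Qed.

Lemma CSeries_unif_cvg_filterlim (D : R -> Prop) (f : nat -> R -> C) (x : R) :
  CSeries_unif_cvg D f -> D x ->
  filterlim (fun n => sum_n (fun k => f k x) n) eventually (locally (CSeries (fun k => f k x))).
Proof.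
  intros H Dx. apply filterlim_C. intros eps He. destruct (H eps He) as [N HN].
  exists N. intros n Hn. now apply HN.
Qed.

Lemma continuous_sum_n_C (g : nat -> R -> C) (x : R) (n : nat) :
  (forall k, continuous (g k) x) -> continuous (fun t => sum_n (fun k => g k t) n) x.
Proof.
  intros H. induction n as [|n IH].
  - apply continuous_ext with (g 0%nat); [|apply H]. intros t. now rewrite sum_O.
  - apply continuous_ext with (fun t => sum_n (fun k => g k t) n + g (S n) t).
    + intros t. now rewrite sum_Sn.
    + apply filterlim_Cplus; [exact IH|apply H].
Qed.

(** The form fits iterated integrals of one parity, whose derivatives are those of the other parity
    times a weight [v]. Boundedness of [v] keeps the convergence of the derivatives uniform near
    [x]. *)
Lemma is_derive_limit_of_sums (s g : nat -> R -> C) (f v : R -> C) (x M : R) :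
  (forall n t, is_derive_C (s n) t (sum_n (fun k => g k t) n * v t)) ->
  (forall n t, continuous (g n) t) -> (forall t, continuous v t) ->
  (forall t, (Cmod (v t) <= M)%R) ->
  (forall t, filterlim (fun n => s n t) eventually (locally (f t))) ->
  CSeries_unif_cvg (fun t => (Rabs (t - x) < 1)%R) g ->
  is_derive_C f x (CSeries (fun k => g k x) * v x).
Proof.
  intros Hs Hg Hv HM Hf Hu.
  apply (is_derive_sequence_limit s (fun n t => sum_n (fun k => g k t) n * v t) f
    (fun t => CSeries (fun k => g k t) * v t) x 1); auto using Rlt_0_1.
  - intros n t. apply filterlim_Cmult; [|apply Hv]. apply continuous_sum_n_C. auto.
  - intros eps He.
    assert (HM0 : (0 <= M)%R) by (eapply Rle_trans; [apply Cmod_ge_0|apply (HM x)]).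
    (* The denominator [M + 1] stays positive when [M] is zero. *)
    assert (He' : (0 < eps / (M + 1))%R) by (apply Rdiv_lt_0_compat; lra).
    destruct (Hu _ He') as [N HN]. exists N. intros n Hn t Ht.
    specialize (HN n Hn t Ht).
    replace (sum_n (fun k => g k t) n * v t - CSeries (fun k => g k t) * v t)
      with ((sum_n (fun k => g k t) n - CSeries (fun k => g k t)) * v t) by ring.
    rewrite Cmod_mult.
    apply Rle_lt_trans with (eps / (M + 1) * M)%R.
    + apply Rmult_le_compat; auto using Cmod_ge_0. now left.
    + apply (Rmult_lt_reg_r (M + 1)); [lra|].
      replace (eps / (M + 1) * M * (M + 1))%R with (eps * M)%R by (field; lra).
      apply Rmult_lt_compat_l; lra.
Qed.

(** * Alternating weights and the first-order system *)

(* [alternate u0sq_r inv_u0sq_p] gives [Xtilde], [alternate inv_u0sq_p u0sq_r]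
   gives [X]. *)
Definition alternate (alpha beta : R -> C) (n : nat) : R -> C :=
  if Nat.odd n then alpha else beta.

Definition even_sum (w : nat -> R -> C) (x0 x : R) : C :=
  CSeries (fun k => iter_int w x0 (2 * k) x).

Definition odd_sum (w : nat -> R -> C) (x0 x : R) : C :=
  CSeries (fun k => iter_int w x0 (2 * k + 1) x).

Section Alternating_iterated_integrals.

Variables alpha beta : R -> C.
Variables x0 M : R.
Hypothesis alpha_cont : forall x, continuous alpha x.
Hypothesis beta_cont : forall x, continuous beta x.
Hypothesis alpha_le : forall x, (Cmod (alpha x) <= M)%R.
Hypothesis beta_le : forall x, (Cmod (beta x) <= M)%R.

Let w := alternate alpha beta.

Lemma alternate_cont (n : nat) (x : R) : continuous (w n) x.
Proof. unfold w, alternate. destruct (Nat.odd n); auto. Qed.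

Lemma alternate_le (n : nat) (x : R) : (Cmod (w n x) <= M)%R.
Proof. unfold w, alternate. destruct (Nat.odd n); auto. Qed.

Lemma alternate_odd (k : nat) : w (S (2 * k)) = alpha.
Proof.
  unfold w, alternate. rewrite Nat.odd_succ, Nat.even_mul. reflexivity.
Qed.

Lemma alternate_even (k : nat) : w (S (2 * k + 1)) = beta.
Proof.
  unfold w, alternate. rewrite Nat.odd_succ, Nat.add_1_r, Nat.even_succ, Nat.odd_mul. reflexivity.
Qed.

(** Replacing [fact (2 * k + i)] by the smaller [fact k] turns the factorial bound, for either
    parity, into a multiple of the exponential series at [(M * L) ^ 2]. *)
Lemma Cmod_iter_int_le_exp (L x : R) (i k : nat) :
  (Rabs (x - x0) <= L)%R ->
  (Cmod (iter_int w x0 (2 * k + i) x) <= (M * L) ^ i * (((M * L) ^ 2) ^ k / INR (fact k)))%R.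
Proof.
  intros HL.
  assert (HM0 : (0 <= M)%R) by (eapply Rle_trans; [apply Cmod_ge_0|apply (alpha_le x)]).
  assert (HL0 : (0 <= L)%R) by (eapply Rle_trans; [apply Rabs_pos|exact HL]).
  eapply Rle_trans.
  { apply (Cmod_iter_int_le w x0 alternate_cont M). exact alternate_le. }
  rewrite <- Rpow_mult_distr.
  apply Rle_trans with ((M * L) ^ (2 * k + i) / INR (fact (2 * k + i)))%R.
  - apply Rmult_le_compat_r.
    + left. apply Rinv_0_lt_compat, INR_fact_lt_0.
    + apply pow_incr. split.
      * apply Rmult_le_pos; [exact HM0|apply Rabs_pos].
      * now apply Rmult_le_compat_l.
  - rewrite Nat.add_comm, pow_add, <- pow_mult. unfold Rdiv. rewrite Rmult_assoc.
    assert (HML : (0 <= M * L)%R) by now apply Rmult_le_pos.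
    apply Rmult_le_compat_l; [now apply pow_le|].
    apply Rmult_le_compat_l; [now apply pow_le|].
    apply Rinv_le_contravar; [apply INR_fact_lt_0|]. apply le_INR, fact_le. lia.
Qed.

Lemma iter_int_unif_cvg (D : R -> Prop) (L : R) (i : nat) :
  (forall x, D x -> (Rabs (x - x0) <= L)%R) ->
  CSeries_unif_cvg D (fun k => iter_int w x0 (2 * k + i)).
Proof.
  intros HD.
  apply (CSeries_unif_cvg_M_test D _ (fun k => (M * L) ^ i * (((M * L) ^ 2) ^ k / INR (fact k)))%R).
  - apply (ex_series_scal (V := R_NormedModule) ((M * L) ^ i)%R
      (fun k => ((M * L) ^ 2) ^ k / INR (fact k))%R).
    exists (exp ((M * L) ^ 2)). generalize (is_exp_Reals ((M * L) ^ 2)).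
    apply is_series_ext. intros n.
    change (pow_n ((M * L) ^ 2)%R n * / INR (fact n) = ((M * L) ^ 2) ^ n / INR (fact n))%R.
    now rewrite pow_n_pow.
  - intros k x Dx. now apply Cmod_iter_int_le_exp, HD.
Qed.

Lemma even_unif_cvg (D : R -> Prop) (L : R) :
  (forall x, D x -> (Rabs (x - x0) <= L)%R) ->
  CSeries_unif_cvg D (fun k => iter_int w x0 (2 * k)).
Proof.
  intros HD eps He. destruct (iter_int_unif_cvg D L 0 HD eps He) as [N HN].
  exists N. intros n Hn x Dx. specialize (HN n Hn x Dx).
  assert (E : (fun k => iter_int w x0 (2 * k + 0) x) = (fun k => iter_int w x0 (2 * k) x)).
  { apply FunctionalExtensionality.functional_extensionality. intros k. now rewrite Nat.add_0_r. }
  rewrite E in HN. exact HN.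
Qed.

Lemma even_filterlim (t : R) :
  filterlim (fun n => sum_n (fun k => iter_int w x0 (2 * k) t) n) eventually (locally (even_sum w x0 t)).
Proof.
  (* Pointwise convergence is uniform convergence on a singleton. *)
  apply (CSeries_unif_cvg_filterlim (fun y => y = t) (fun k => iter_int w x0 (2 * k))); [|reflexivity].
  apply even_unif_cvg with (Rabs (t - x0)). intros y ->. apply Rle_refl.
Qed.

Lemma odd_filterlim (t : R) :
  filterlim (fun n => sum_n (fun k => iter_int w x0 (2 * k + 1) t) n) eventually (locally (odd_sum w x0 t)).
Proof.
  apply (CSeries_unif_cvg_filterlim (fun y => y = t) (fun k => iter_int w x0 (2 * k + 1))); [|reflexivity].
  apply iter_int_unif_cvg with (Rabs (t - x0)). intros y ->. apply Rle_refl.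
Qed.

Lemma Rabs_sub_le_ball (x t : R) : (Rabs (t - x) < 1)%R -> (Rabs (t - x0) <= Rabs (x - x0) + 1)%R.
Proof.
  intros Ht. replace (t - x0)%R with ((t - x) + (x - x0))%R by ring.
  eapply Rle_trans; [apply Rabs_triang|]. lra.
Qed.

Lemma is_derive_even_sum (x : R) :
  is_derive_C (even_sum w x0) x (odd_sum w x0 x * beta x).
Proof.
  (* The term of index 0 is constant, hence the shift: even terms up to [S n] differentiate to odd
     terms up to [n], times [beta]. *)
  apply (is_derive_limit_of_sums (fun n t => sum_n (fun k => iter_int w x0 (2 * k) t) (S n))
    (fun k => iter_int w x0 (2 * k + 1)) _ beta x M); auto.
  - intros n t. induction n as [|n IH].
    + apply (is_derive_ext (fun t => 1 + iter_int w x0 2 t)).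
      * intros y. now rewrite sum_Sn, sum_O.
      * rewrite sum_O.
        replace (iter_int w x0 (2 * 0 + 1) t * beta t) with (0 + iter_int w x0 (2 * 0 + 1) t * beta t) by ring.
        apply (is_derive_plus (K := R_AbsRing) (V := C_R_NormedModule)).
        -- apply (is_derive_const (K := R_AbsRing) (V := C_R_NormedModule)).
        -- apply (is_derive_iter_int w x0 alternate_cont 1).
    + eapply (is_derive_ext (fun t => sum_n (fun k => iter_int w x0 (2 * k) t) (S n) + iter_int w x0 (2 * S (S n)) t)).
      * intros y. now rewrite (sum_Sn _ (S n)).
      * rewrite sum_Sn.
        change (plus ?u ?v * beta t) with ((u + v) * beta t). rewrite Cmult_plus_distr_r.
        apply (is_derive_plus (K := R_AbsRing) (V := C_R_NormedModule)); [exact IH|].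
        rewrite <- (alternate_even (S n)).
        replace (2 * S (S n))%nat with (S (2 * S n + 1)) by lia.
        apply (is_derive_iter_int w x0 alternate_cont).
  - intros n t. apply continuous_iter_int, alternate_cont.
  - intros t. generalize (even_filterlim t). intros H P HP.
    destruct (H P HP) as [N HN]. exists N. intros n Hn. apply HN. lia.
  - apply iter_int_unif_cvg with (Rabs (x - x0) + 1)%R. apply Rabs_sub_le_ball.
Qed.

Lemma is_derive_odd_sum (x : R) :
  is_derive_C (odd_sum w x0) x (even_sum w x0 x * alpha x).
Proof.
  apply (is_derive_limit_of_sums (fun n t => sum_n (fun k => iter_int w x0 (2 * k + 1) t) n)
    (fun k => iter_int w x0 (2 * k)) _ alpha x M); auto.
  - intros n t. induction n as [|n IH].
    + apply (is_derive_ext (iter_int w x0 1)).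
      * intros y. now rewrite sum_O.
      * rewrite sum_O. apply (is_derive_iter_int w x0 alternate_cont 0).
    + eapply (is_derive_ext (fun t => sum_n (fun k => iter_int w x0 (2 * k + 1) t) n + iter_int w x0 (2 * S n + 1) t)).
      * intros y. now rewrite sum_Sn.
      * rewrite sum_Sn.
        change (plus ?u ?v * alpha t) with ((u + v) * alpha t). rewrite Cmult_plus_distr_r.
        apply (is_derive_plus (K := R_AbsRing) (V := C_R_NormedModule)); [exact IH|].
        rewrite <- (alternate_odd (S n)), Nat.add_1_r.
        apply (is_derive_iter_int w x0 alternate_cont).
  - intros n t. apply continuous_iter_int, alternate_cont.
  - intros t. apply odd_filterlim.
  - apply even_unif_cvg with (Rabs (x - x0) + 1)%R. apply Rabs_sub_le_ball.
Qed.

(** Every integral except the constant one at stage 0 vanishes at [x0]. *)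
Lemma even_sum_at : even_sum w x0 x0 = 1.
Proof.
  apply (filterlim_locally_unique (F := eventually) (V := C_R_NormedModule)
    (fun n => sum_n (fun k => iter_int w x0 (2 * k) x0) n)).
  { apply even_filterlim. }
  apply filterlim_ext with (fun _ : nat => RtoC 1 : C); [|apply filterlim_const].
  intros n. induction n as [|n IH].
  - now rewrite sum_O.
  - rewrite sum_Sn, <- IH. replace (2 * S n)%nat with (S (2 * n + 1)) by lia.
    rewrite iter_int_at. symmetry. apply Cplus_0_r.
Qed.

Lemma odd_sum_at : odd_sum w x0 x0 = 0.
Proof.
  apply (filterlim_locally_unique (F := eventually) (V := C_R_NormedModule)
    (fun n => sum_n (fun k => iter_int w x0 (2 * k + 1) x0) n)).
  { apply odd_filterlim. }
  apply filterlim_ext with (fun _ : nat => RtoC 0 : C); [|apply filterlim_const].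
  intros n. induction n as [|n IH].
  - rewrite sum_O. symmetry. apply (iter_int_at w x0 0).
  - rewrite sum_Sn, <- IH. replace (2 * S n + 1)%nat with (S (2 * S n)) by lia.
    rewrite iter_int_at. symmetry. apply Cplus_0_r.
Qed.

End Alternating_iterated_integrals.

(** * Powers of lambda and the functions [Xtilde] and [X] *)

(** The scalars of [C_R_NormedModule] are real, so a complex factor is moved out through real and
    imaginary parts. *)
Lemma is_RInt_Cmult (c : C) (f : R -> C) (x y : R) (I : C) :
  is_RInt (V := C_R_NormedModule) f x y I ->
  is_RInt (V := C_R_NormedModule) (fun s => c * f s) x y (c * I).
Proof.
  intros H.
  pose proof (is_RInt_fct_extend_fst (U := R_NormedModule) (V := R_NormedModule) _ _ _ _ H) as H1.
  pose proof (is_RInt_fct_extend_snd (U := R_NormedModule) (V := R_NormedModule) _ _ _ _ H) as H2.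
  apply (is_RInt_fct_extend_pair (U := R_NormedModule) (V := R_NormedModule)).
  - apply (is_RInt_minus (V := R_NormedModule) (fun s => fst c * fst (f s))%R (fun s => snd c * snd (f s))%R);
      now apply (is_RInt_scal (V := R_NormedModule)).
  - apply (is_RInt_plus (V := R_NormedModule) (fun s => fst c * snd (f s))%R (fun s => snd c * fst (f s))%R);
      now apply (is_RInt_scal (V := R_NormedModule)).
Qed.

(** [c n] is the product of the factors acquired by the weights up to stage [n]. The relation
    between [w] and [w'] is written without division, so that [lam = 0] is covered. *)
Lemma iter_int_scal (w w' : nat -> R -> C) (c : nat -> C) (x0 x : R) (n : nat) :
  (forall n x, continuous (w n) x) -> c 0%nat = 1 ->
  (forall n s, c n * w' (S n) s = c (S n) * w (S n) s) ->
  iter_int w' x0 n x = c n * iter_int w x0 n x.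
Proof.
  intros Hw Hc0 Hc. revert x. induction n as [|n IH]; intros x.
  - simpl. rewrite Hc0. ring.
  - apply (is_RInt_unique (V := C_R_CompleteNormedModule)).
    apply (is_RInt_ext (V := C_R_NormedModule) (fun s => c (S n) * (iter_int w x0 n s * w (S n) s))).
    + intros s _. rewrite IH.
      change (@eq C (c (S n) * (iter_int w x0 n s * w (S n) s)) (c n * iter_int w x0 n s * w' (S n) s)).
      transitivity (iter_int w x0 n s * (c (S n) * w (S n) s)); [|rewrite <- Hc]; ring.
    + apply is_RInt_Cmult, is_RInt_iter_int, Hw.
Qed.

(** With both end points in the interval, no stage of the integration leaves it. The weights may
    thus be exchanged for their extensions to the line. *)
Lemma iter_int_ext (w w' : nat -> R -> C) (a b x0 x : R) (n : nat) :
  (forall n s, cintv a b s -> w n s = w' n s) -> cintv a b x0 -> cintv a b x ->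
  iter_int w x0 n x = iter_int w' x0 n x.
Proof.
  intros Hw Hx0. revert x. induction n as [|n IH]; intros x Hx; [reflexivity|].
  apply (RInt_ext (V := C_R_CompleteNormedModule)). intros s Hs.
  assert (Ds : cintv a b s).
  { revert Hs. unfold cintv, Rmin, Rmax in *. destruct (Rle_dec x0 x); lra. }
  rewrite IH, Hw; auto.
Qed.

Lemma Xtilde_iter_int (p r u0 : R -> C) (x0 x : R) (n : nat) :
  Xtilde p r u0 x0 n x = iter_int (alternate (u0sq_r r u0) (inv_u0sq_p p u0)) x0 n x.
Proof.
  revert x. induction n as [|n IH]; intros x; [reflexivity|].
  cbn [Xtilde iter_int]. unfold alternate at 2.
  destruct (Nat.odd (S n)); apply (RInt_ext (V := C_R_CompleteNormedModule)); intros s _; now rewrite IH.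
Qed.

Lemma X_iter_int (p r u0 : R -> C) (x0 x : R) (n : nat) :
  X p r u0 x0 n x = iter_int (alternate (inv_u0sq_p p u0) (u0sq_r r u0)) x0 n x.
Proof.
  revert x. induction n as [|n IH]; intros x; [reflexivity|].
  cbn [X iter_int]. unfold alternate at 2.
  destruct (Nat.odd (S n)); apply (RInt_ext (V := C_R_CompleteNormedModule)); intros s _; now rewrite IH.
Qed.

Lemma iter_int_scal_odd (alpha beta : R -> C) (lam : C) (x0 x : R) (k : nat) :
  (forall x, continuous alpha x) -> (forall x, continuous beta x) ->
  iter_int (alternate (fun s => lam * alpha s) beta) x0 (2 * k) x =
  lam ^ k * iter_int (alternate alpha beta) x0 (2 * k) x.
Proof.
  intros Ha Hb.
  (* [Nat.div2 (S n)] counts the odd stages up to [n], those at which a factor [lam] enters. *)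
  rewrite (iter_int_scal (alternate alpha beta) _ (fun n => lam ^ (Nat.div2 (S n)))).
  - now rewrite Nat.div2_succ_double.
  - intros n y. now apply alternate_cont.
  - reflexivity.
  - intros n s. unfold alternate.
    change (Nat.div2 (S (S n))) with (S (Nat.div2 n)).
    destruct (Nat.Even_or_Odd n) as [[m ->]|[m ->]].
    + rewrite Nat.div2_succ_double, Nat.div2_double, Nat.odd_succ, Nat.even_mul. simpl. ring.
    + rewrite Nat.add_1_r, Nat.div2_succ_double, !Nat.odd_succ, Nat.even_succ, Nat.odd_mul.
      replace (S (S (2 * m))) with (2 * S m)%nat by lia. rewrite Nat.div2_double. reflexivity.
Qed.

Lemma iter_int_scal_even (alpha beta : R -> C) (lam : C) (x0 x : R) (k : nat) :
  (forall x, continuous alpha x) -> (forall x, continuous beta x) ->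
  iter_int (alternate alpha (fun s => lam * beta s)) x0 (2 * k + 1) x =
  lam ^ k * iter_int (alternate alpha beta) x0 (2 * k + 1) x.
Proof.
  intros Ha Hb.
  (* Here [lam] enters at the even stages from 2 on, of which [Nat.div2 n] occur up to [n]. *)
  rewrite (iter_int_scal (alternate alpha beta) _ (fun n => lam ^ (Nat.div2 n))).
  - now rewrite Nat.add_1_r, Nat.div2_succ_double.
  - intros n y. now apply alternate_cont.
  - reflexivity.
  - intros n s. unfold alternate.
    destruct (Nat.Even_or_Odd n) as [[m ->]|[m ->]].
    + rewrite Nat.div2_succ_double, Nat.div2_double, Nat.odd_succ, Nat.even_mul. reflexivity.
    + rewrite Nat.add_1_r, Nat.div2_succ_double, !Nat.odd_succ, Nat.even_succ, Nat.odd_mul.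
      replace (S (S (2 * m))) with (2 * S m)%nat by lia. rewrite Nat.div2_double. simpl. ring.
Qed.

(** * Continuous extension from the interval to the line *)

(** For [a < b] this is the nearest-point retraction onto [[a,b]]; composition with it extends a
    function by its end values. *)
Definition clamp (a b x : R) : R := Rmax a (Rmin b x).

Lemma clamp_in (a b x : R) : (a < b)%R -> cintv a b (clamp a b x).
Proof.
  unfold cintv, clamp, Rmax, Rmin. intros.
  destruct (Rle_dec b x); destruct Rle_dec; lra.
Qed.

Lemma clamp_id (a b x : R) : cintv a b x -> clamp a b x = x.
Proof.
  unfold cintv, clamp, Rmax, Rmin. intros.
  destruct (Rle_dec b x); destruct Rle_dec; lra.
Qed.

Lemma clamp_dist (a b x y : R) :
  (a < b)%R -> (Rabs (clamp a b y - clamp a b x) <= Rabs (y - x))%R.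
Proof.
  unfold clamp, Rmax, Rmin, Rabs. intros.
  repeat (destruct Rle_dec || destruct Rcase_abs); lra.
Qed.

(** [clamp] is 1-Lipschitz with values in the interval, so continuity relative to the interval
    suffices. *)
Lemma continuous_clamp (a b : R) (f : R -> C) (x : R) :
  (a < b)%R -> continuous_on (cintv a b) f -> continuous (fun s => f (clamp a b s)) x.
Proof.
  intros Hab Hf P HP.
  destruct (Hf (clamp a b x) (clamp_in _ _ _ Hab) P HP) as [d Hd].
  exists d. intros y Hy. apply Hd; [|now apply clamp_in].
  eapply Rle_lt_trans; [now apply clamp_dist|exact Hy].
Qed.

(** The extreme value theorem bounds the modulus on [[a,b]], and the extension takes no other
    values. *)
Lemma bounded_clamp (a b : R) (f : R -> C) :
  (a < b)%R -> continuous_on (cintv a b) f -> exists M : R, forall x, (Cmod (f (clamp a b x)) <= M)%R.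
Proof.
  intros Hab Hf.
  destruct (continuity_ab_maj (fun x => Cmod (f (clamp a b x))) a b) as [m [Hm _]]; [lra| |].
  - intros x _. apply continuity_pt_filterlim.
    pose proof (continuous_clamp a b f x Hab Hf) as Hc. unfold continuous in Hc.
    rewrite filterlim_C in Hc. apply (filterlim_locally (U := R_UniformSpace)). intros eps.
    generalize (Hc eps (cond_pos eps)). apply filter_imp. intros y Hy.
    change (Rabs (Cmod (f (clamp a b y)) - Cmod (f (clamp a b x))) < eps)%R.
    eapply Rle_lt_trans; [|exact Hy].
    rewrite !Cmod_norm. apply (norm_triangle_inv (V := C_R_NormedModule)).
  - exists (Cmod (f (clamp a b m))). intros x.
    specialize (Hm (clamp a b x) (clamp_in _ _ _ Hab)). simpl in Hm.
    rewrite (clamp_id a b (clamp a b x)) in Hm by now apply clamp_in. exact Hm.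
Qed.

(** * From the system to the equation, and Wronskians *)

(** The derivatives hidden in [SL_solution] are kept explicit because Wronskians are formed from
    [p * du]. *)
Definition SL_data (D : R -> Prop) (p q r : R -> C) (lam : C) (u du dv : R -> C) : Prop :=
  forall x : R, D x ->
    is_derive_within D u x (du x) /\
    is_derive_within D (fun y => p y * du y) x (dv x) /\
    dv x + q x * u x = lam * r x * u x.

(* The first-order system is satisfied by [S = u / u0] and
   [T = u0 * (p u') - (p u0') * u]. *)
Lemma SL_data_of_system (D : R -> Prop) (p q r : R -> C) (lam : C) (u0 du0 dv0 S T u : R -> C) :
  SL_data D p q r 0 u0 du0 dv0 ->
  (forall x, D x -> u0 x ^ 2 * p x <> 0) ->
  (forall x, D x -> is_derive_within D S x (T x * inv_u0sq_p p u0 x)) ->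
  (forall x, D x -> is_derive_within D T x (S x * (lam * u0sq_r r u0 x))) ->
  (forall x, D x -> u x = u0 x * S x) ->
  exists du dv, SL_data D p q r lam u du dv /\
    forall x, D x -> p x * du x = p x * du0 x * S x + T x * / u0 x.
Proof.
  intros H0 Hnz HS HT Hu.
  assert (Hu0 : forall x, D x -> u0 x <> 0).
  { intros x Dx E. apply (Hnz x Dx). rewrite E. simpl. ring. }
  assert (Hp : forall x, D x -> p x <> 0).
  { intros x Dx E. apply (Hnz x Dx). rewrite E. ring. }
  exists (fun x => du0 x * S x + u0 x * (T x * inv_u0sq_p p u0 x)),
    (fun x => (dv0 x * S x + p x * du0 x * (T x * inv_u0sq_p p u0 x)) +
      (S x * (lam * u0sq_r r u0 x) * / u0 x + T x * (- du0 x / (u0 x * u0 x)))).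
  (* [p] alone need not be differentiable, so [p u'] is rewritten through [p u0'], whose derivative
     is known. *)
  assert (Hv : forall x, D x -> p x * du0 x * S x + T x * / u0 x =
    p x * (du0 x * S x + u0 x * (T x * inv_u0sq_p p u0 x))).
  { intros x Dx. unfold inv_u0sq_p. simpl. field. split; auto. }
  split; [|intros x Dx; symmetry; auto].
  intros x Dx. destruct (H0 x Dx) as [Hdu [Hdv Heq]]. split; [|split].
  - apply is_derive_within_ext with (fun y => u0 y * S y); [exact Dx|intros y Dy; symmetry; auto|].
    apply is_derive_within_mult; auto.
  - apply is_derive_within_ext with (fun y => p y * du0 y * S y + T y * / u0 y); [exact Dx|exact Hv|].
    apply is_derive_within_plus; [exact Dx| |].
    + apply (is_derive_within_mult D x Dx (fun y => p y * du0 y)); auto.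
    + apply is_derive_within_mult; auto. apply is_derive_within_inv; auto.
  - rewrite Hu by exact Dx.
    (* The equation for [u0] eliminates [dv0]; the two terms containing [du0 x * T x] cancel. *)
    replace (dv0 x) with (- (q x * u0 x)).
    2: { replace (dv0 x) with (dv0 x + q x * u0 x - q x * u0 x) by ring. rewrite Heq. ring. }
    unfold inv_u0sq_p, u0sq_r. simpl. field. split; auto.
Qed.

(** By Lagrange's identity the derivative is [u1 dv2 - dv1 u2], in which the contributions of [q]
    and [lam * r] cancel. *)
Lemma wronskian_const (a b : R) (p q r : R -> C) (lam : C) (u1 du1 dv1 u2 du2 dv2 : R -> C) :
  SL_data (ointv a b) p q r lam u1 du1 dv1 -> SL_data (ointv a b) p q r lam u2 du2 dv2 ->
  forall x y, ointv a b x -> ointv a b y ->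
    u1 x * (p x * du2 x) + - (1) * (p x * du1 x * u2 x) =
    u1 y * (p y * du2 y) + - (1) * (p y * du1 y * u2 y).
Proof.
  intros H1 H2.
  apply (is_derive_within_zero_const a b
    (fun x => u1 x * (p x * du2 x) + - (1) * (p x * du1 x * u2 x))).
  intros x Dx. destruct (H1 x Dx) as [Hu1 [Hv1 E1]]. destruct (H2 x Dx) as [Hu2 [Hv2 E2]].
  replace (RtoC 0) with ((du1 x * (p x * du2 x) + u1 x * dv2 x) +
    (0 * (p x * du1 x * u2 x) + - (1) * (dv1 x * u2 x + p x * du1 x * du2 x))).
  - apply is_derive_within_plus; [exact Dx| |].
    + apply (is_derive_within_mult _ x Dx u1 (fun y => p y * du2 y)); auto.
    + apply (is_derive_within_mult _ x Dx (fun _ => - (1))); [now apply is_derive_within_const|].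
      apply (is_derive_within_mult _ x Dx (fun y => p y * du1 y)); auto.
  - replace (dv1 x) with ((dv1 x + q x * u1 x) - q x * u1 x) by ring.
    replace (dv2 x) with ((dv2 x + q x * u2 x) - q x * u2 x) by ring.
    rewrite E1, E2. ring.
Qed.

(** A unit Wronskian makes the linear system for the coefficients invertible, which gives
    independence; it also turns the three-function Wronskian identity into the representation of an
    arbitrary solution. *)
Lemma SL_general_solution_of_wronskian (a b : R) (p q r : R -> C) (lam : C)
    (u1 du1 dv1 u2 du2 dv2 : R -> C) :
  (a < b)%R ->
  SL_data (ointv a b) p q r lam u1 du1 dv1 -> SL_data (ointv a b) p q r lam u2 du2 dv2 ->
  (forall x, ointv a b x -> u1 x * (p x * du2 x) - p x * du1 x * u2 x = 1) ->
  SL_general_solution (ointv a b) p q r lam u1 u2.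
Proof.
  intros Hab H1 H2 HW.
  set (m := ((a + b) / 2)%R).
  assert (Dm : ointv a b m) by (unfold ointv, m; lra).
  split; [now exists du1, dv1|]. split; [now exists du2, dv2|]. split.
  - intros c1 c2 H.
    destruct (H1 m Dm) as [Hu1 _]. destruct (H2 m Dm) as [Hu2 _].
    assert (Hd : (0 * u1 m + c1 * du1 m) + (0 * u2 m + c2 * du2 m) = 0).
    { apply (is_derive_within_zero a b (fun x => c1 * u1 x + c2 * u2 x) m); auto.
      apply is_derive_within_plus; [exact Dm| |];
        apply (is_derive_within_mult _ m Dm); auto; now apply is_derive_within_const. }
    specialize (H m Dm). specialize (HW m Dm). split.
    (* Cramer's rule for the relation [H] and its derivative [Hd], with determinant 1. *)
    + transitivity (c1 * (u1 m * (p m * du2 m) - p m * du1 m * u2 m)); [rewrite HW; ring|].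
      transitivity ((c1 * u1 m + c2 * u2 m) * (p m * du2 m) -
        p m * u2 m * ((0 * u1 m + c1 * du1 m) + (0 * u2 m + c2 * du2 m))); [ring|].
      rewrite H, Hd. ring.
    + transitivity (c2 * (u1 m * (p m * du2 m) - p m * du1 m * u2 m)); [rewrite HW; ring|].
      transitivity (p m * u1 m * ((0 * u1 m + c1 * du1 m) + (0 * u2 m + c2 * du2 m)) -
        p m * du1 m * (c1 * u1 m + c2 * u2 m)); [ring|].
      rewrite H, Hd. ring.
  - intros u [du [dv Hu]].
    (* The coefficients are W(u, u2) and -W(u, u1) taken at [m]. Constancy moves them to [x], where
       W(u, u2) u1 - W(u, u1) u2 = u W(u1, u2) is an algebraic identity. *)
    exists (u m * (p m * du2 m) + - (1) * (p m * du m * u2 m)),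
      (- (u m * (p m * du1 m) + - (1) * (p m * du m * u1 m))).
    intros x Dx.
    rewrite (wronskian_const _ _ _ _ _ _ _ _ _ _ _ _ Hu H2 m x Dm Dx).
    rewrite (wronskian_const _ _ _ _ _ _ _ _ _ _ _ _ Hu H1 m x Dm Dx).
    transitivity (u x * (u1 x * (p x * du2 x) - p x * du1 x * u2 x)); [rewrite HW by exact Dx|]; ring.
Qed.

(** The system has zero trace, so by Liouville's formula its determinant is constant. *)
Lemma system_wronskian (alpha beta S1 T1 S2 T2 : R -> C) (x0 x : R) :
  (forall y, is_derive_C S1 y (T1 y * beta y)) -> (forall y, is_derive_C T1 y (S1 y * alpha y)) ->
  (forall y, is_derive_C S2 y (T2 y * beta y)) -> (forall y, is_derive_C T2 y (S2 y * alpha y)) ->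
  S1 x * T2 x + - (1) * (T1 x * S2 x) = S1 x0 * T2 x0 + - (1) * (T1 x0 * S2 x0).
Proof.
  intros HS1 HT1 HS2 HT2.
  (* The margin 1 puts both [x] and [x0] inside an open interval. *)
  apply (is_derive_within_zero_const (Rmin x x0 - 1) (Rmax x x0 + 1)
    (fun y => S1 y * T2 y + - (1) * (T1 y * S2 y))).
  2,3: unfold ointv, Rmin, Rmax; destruct Rle_dec; lra.
  intros y Dy.
  replace (RtoC 0) with ((T1 y * beta y * T2 y + S1 y * (S2 y * alpha y)) +
    (0 * (T1 y * S2 y) + - (1) * (S1 y * alpha y * S2 y + T1 y * (T2 y * beta y)))) by ring.
  apply is_derive_within_plus; [exact Dy| |].
  - apply is_derive_within_mult; auto using is_derive_is_derive_within.
  - apply is_derive_within_mult; auto using is_derive_within_const.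
    apply is_derive_within_mult; auto using is_derive_is_derive_within.
Qed.

(** * Assembly of the series, the two solutions and their Wronskian *)

Lemma CSeries_unif_cvg_ext (D : R -> Prop) (f g : nat -> R -> C) :
  (forall k x, D x -> f k x = g k x) -> CSeries_unif_cvg D f -> CSeries_unif_cvg D g.
Proof.
  intros E H eps He. destruct (H eps He) as [N HN]. exists N. intros n Hn x Dx.
  assert (Ex : (fun k => f k x) = (fun k => g k x)).
  { apply functional_extensionality. auto. }
  rewrite <- Ex. now apply HN.
Qed.

Theorem theorem1 :
  forall (a b : R) (p q r : R -> C) (lam : C) (u0 : R -> C) (x0 : R),
    (a < b)%R ->
    SL_solution (cintv a b) p q r 0 u0 ->
    (forall x : R, cintv a b x -> u0 x ^ 2 * p x <> 0) ->
    continuous_on (cintv a b) (u0sq_r r u0) ->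
    continuous_on (cintv a b) (inv_u0sq_p p u0) ->
    cintv a b x0 ->
    filterlim p (within (cintv a b) (locally x0)) (locally (p x0)) ->
    p x0 <> 0 ->
    SL_general_solution (ointv a b) p q r lam
      (fun x => u0 x * CSeries (fun k => term1 p r u0 x0 lam k x))
      (fun x => u0 x * CSeries (fun k => term2 p r u0 x0 lam k x)) /\
    CSeries_unif_cvg (cintv a b) (term1 p r u0 x0 lam) /\
    CSeries_unif_cvg (cintv a b) (term2 p r u0 x0 lam).
Proof.
  intros a b p q r lam u0 x0 Hab [du0 [dv0 H0]] Hnz Hr Hp Hx0 _ _.
  set (rho := fun s => u0sq_r r u0 (clamp a b s)).
  (* With [lam] absorbed into the weight, the power series in [lam] become plain sums of iterated
     integrals. *)
  set (alpha := fun s => lam * rho s).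
  set (beta := fun s => inv_u0sq_p p u0 (clamp a b s)).
  assert (Hrho : forall x, continuous rho x) by (intros x; now apply continuous_clamp).
  assert (Hbeta : forall x, continuous beta x) by (intros x; now apply continuous_clamp).
  assert (Halpha : forall x, continuous alpha x).
  { intros x. apply continuous_Cmult; [apply continuous_const|apply Hrho]. }
  destruct (bounded_clamp a b _ Hab Hr) as [Mr HMr].
  destruct (bounded_clamp a b _ Hab Hp) as [Mp HMp].
  set (M := Rmax (Cmod lam * Mr) Mp).
  assert (HMb : forall x, (Cmod (beta x) <= M)%R).
  { intros x. eapply Rle_trans; [apply HMp|apply Rmax_r]. }
  assert (HMa : forall x, (Cmod (alpha x) <= M)%R).
  { intros x. eapply Rle_trans; [|apply Rmax_l]. unfold alpha. rewrite Cmod_mult.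
    apply Rmult_le_compat_l; [apply Cmod_ge_0|apply HMr]. }
  set (w1 := alternate alpha beta). set (w2 := alternate beta alpha).
  assert (Et1 : forall k x, cintv a b x -> iter_int w1 x0 (2 * k) x = term1 p r u0 x0 lam k x).
  { intros k x Dx. unfold w1, alpha. rewrite iter_int_scal_odd by assumption.
    unfold term1. rewrite Xtilde_iter_int. f_equal. apply (iter_int_ext _ _ a b); auto.
    intros n s Ds. unfold alternate, rho, beta. now destruct (Nat.odd n); rewrite clamp_id by exact Ds. }
  assert (Et2 : forall k x, cintv a b x -> iter_int w2 x0 (2 * k + 1) x = term2 p r u0 x0 lam k x).
  { intros k x Dx. unfold w2, alpha. rewrite iter_int_scal_even by assumption.
    unfold term2. rewrite X_iter_int. f_equal. apply (iter_int_ext _ _ a b); auto.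
    intros n s Ds. unfold alternate, rho, beta. now destruct (Nat.odd n); rewrite clamp_id by exact Ds. }
  assert (HD : forall x, cintv a b x -> (Rabs (x - x0) <= b - a)%R).
  { intros x Dx. unfold cintv in *. apply Rabs_le. lra. }
  split; [|split].
  2: { apply (CSeries_unif_cvg_ext _ _ _ Et1). now apply even_unif_cvg with M (b - a)%R. }
  2: { apply (CSeries_unif_cvg_ext _ _ _ Et2). now apply iter_int_unif_cvg with M (b - a)%R. }
  assert (Hoc : forall x, ointv a b x -> cintv a b x) by (unfold ointv, cintv; intros; lra).
  (* The parities are exchanged between [w1] and [w2] so that both [S1] and [S2] have [beta] as
     outermost weight, and both [T1] and [T2] have [alpha]. *)
  set (S1 := even_sum w1 x0). set (T1 := odd_sum w1 x0).
  set (S2 := odd_sum w2 x0). set (T2 := even_sum w2 x0).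
  assert (HS1 : forall x, is_derive_C S1 x (T1 x * beta x)) by (intros x; now apply is_derive_even_sum with M).
  assert (HT1 : forall x, is_derive_C T1 x (S1 x * alpha x)) by (intros x; now apply is_derive_odd_sum with M).
  assert (HS2 : forall x, is_derive_C S2 x (T2 x * beta x)) by (intros x; now apply is_derive_odd_sum with M).
  assert (HT2 : forall x, is_derive_C T2 x (S2 x * alpha x)) by (intros x; now apply is_derive_even_sum with M).
  assert (H0' : SL_data (ointv a b) p q r 0 u0 du0 dv0).
  { intros x Dx. destruct (H0 x (Hoc x Dx)) as [Hu [Hv E]].
    split; [|split; [|exact E]]; now apply is_derive_within_subset with (cintv a b). }
  assert (Ebeta : forall x, ointv a b x -> inv_u0sq_p p u0 x = beta x).
  { intros x Dx. unfold beta. cbv beta. now rewrite clamp_id by auto. }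
  assert (Ealpha : forall x, ointv a b x -> lam * u0sq_r r u0 x = alpha x).
  { intros x Dx. unfold alpha, rho. cbv beta. now rewrite clamp_id by auto. }

  destruct (SL_data_of_system (ointv a b) p q r lam u0 du0 dv0 S1 T1
    (fun x => u0 x * CSeries (fun k => term1 p r u0 x0 lam k x)) H0') as [du1 [dv1 [Hd1 Hv1]]]; auto.
  { intros x Dx. rewrite Ebeta by exact Dx. now apply is_derive_is_derive_within. }
  { intros x Dx. rewrite Ealpha by exact Dx. now apply is_derive_is_derive_within. }
  { intros x Dx. unfold S1, even_sum. do 2 f_equal. apply functional_extensionality.
    intros k. symmetry. auto. }
  destruct (SL_data_of_system (ointv a b) p q r lam u0 du0 dv0 S2 T2
    (fun x => u0 x * CSeries (fun k => term2 p r u0 x0 lam k x)) H0') as [du2 [dv2 [Hd2 Hv2]]]; auto.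
  { intros x Dx. rewrite Ebeta by exact Dx. now apply is_derive_is_derive_within. }
  { intros x Dx. rewrite Ealpha by exact Dx. now apply is_derive_is_derive_within. }
  { intros x Dx. unfold S2, odd_sum. do 2 f_equal. apply functional_extensionality.
    intros k. symmetry. auto. }
  apply (SL_general_solution_of_wronskian a b p q r lam _ du1 dv1 _ du2 dv2 Hab Hd1 Hd2).
  intros x Dx. rewrite Hv1, Hv2 by exact Dx.
  assert (E1 : CSeries (fun k => term1 p r u0 x0 lam k x) = S1 x).
  { unfold S1, even_sum. f_equal. apply functional_extensionality. intros k. symmetry. auto. }
  assert (E2 : CSeries (fun k => term2 p r u0 x0 lam k x) = S2 x).
  { unfold S2, odd_sum. f_equal. apply functional_extensionality. intros k. symmetry. auto. }
  rewrite E1, E2.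
  assert (Hu0 : u0 x <> 0).
  { intros E. apply (Hnz x (Hoc x Dx)). rewrite E. simpl. ring. }
  (* The terms with [p u0'] cancel, and the factors [u0] and [/ u0] multiply to 1. *)
  transitivity (S1 x * T2 x + - (1) * (T1 x * S2 x)); [now field|].
  (* [x0] may be an end point of [[a,b]]; the extended system lives on the whole line, so its
     determinant can still be evaluated there. *)
  rewrite (system_wronskian alpha beta S1 T1 S2 T2 x0 x) by assumption.
  unfold S1, T1, S2, T2, w1, w2.
  rewrite !(even_sum_at _ _ x0 M), !(odd_sum_at _ _ x0 M) by assumption. ring.
Qed.
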